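(* Let $R=\{r_{ab}\}_{N\times N}$ be the transition rate matrix of an irreducible continuous-time Markov jump process on states $\{1,\dots,N\}$: for $a\neq b$, $r_{ab}\ge 0$ is the rate of jumps from $b$ to $a$, and $r_{bb}=-\sum_{a\neq b} r_{ab}$. Let $\boldsymbol{\pi}$ be the unique stationary distribution ($R\boldsymbol{\pi}=0$, $\boldsymbol{1}^\top\boldsymbol{\pi}=1$), and let $Z=\int_0^\infty\left(e^{Rt}-\boldsymbol{\pi}\boldsymbol{1}^\top\right)\mathrm{d}t$ be the fundamental matrix. Fix distinct states $i\neq j$ and states $k,l$ different from $i$ and $j$. Regard $R$ (and hence $\boldsymbol{\pi}$ and $Z$) as a function of the single off-diagonal rate $r_{ij}>0$, with all other off-diagonal rates held fixed and the diagonal entry $r_{jj}=-\sum_{a\neq j}r_{aj}$ adjusted accordingly, so that $\frac{\mathrm{d}R}{\mathrm{d}r_{ij}}=E_{ij}-E_{jj}$, where $E_{ab}$ denotes the matrix unit with a $1$ in position $(a,b)$. Define $$\chi_{ij}^{kl}=\frac{Z_{ki}-Z_{kj}}{Z_{li}-Z_{lj}}.$$ Then, at every value of $r_{ij}$ where $Z_{li}-Z_{lj}\neq 0$, $\chi_{ij}^{kl}$ is independent of $r_{ij}$, i.e. $\frac{\mathrm{d}\chi_{ij}^{kl}}{\mathrm{d}r_{ij}}=0$.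
   Context: The ratio $\chi_{ij}^{kl}$ equals the long-time limit of the ratio of the responses $\frac{\mathrm{d}}{\mathrm{d}r_{ij}}\langle \tau_k(\tau)\rangle/\frac{\mathrm{d}}{\mathrm{d}r_{ij}}\langle \tau_l(\tau)\rangle$ of the total dwelling times in states $k$ and $l$ up to time $\tau$. Irreducibility is assumed throughout, so the stationary distribution is unique and $\lim_{t\to\infty}e^{Rt}=\boldsymbol{\pi}\boldsymbol{1}^\top$; $\boldsymbol{1}$ is the all-ones column vector. *)

(* Defs.v *)
From HB Require Import structures.
From mathcomp Require Import all_boot all_order all_algebra.
From mathcomp Require Import all_classical all_reals all_analysis.
Set Implicit Arguments. Unset Strict Implicit. Unset Printing Implicit Defensive.
Import Order.TTheory GRing.Theory Num.Theory.
Import numFieldNormedType.Exports.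
Local Open Scope classical_set_scope.
Local Open Scope ring_scope.

Section Defs.
Context {R : realType} {N : nat}.

(* Rate matrix built from off-diagonal rates q a b (rate of jump b -> a);
   diagonal r_bb = - sum_{a <> b} r_ab. *)
Definition ratemx (q : 'I_N -> 'I_N -> R) : 'M[R]_N :=
  \matrix_(a, b) if a == b then - \sum_(c < N | c != b) q c b else q a b.

Definition setrate (q : 'I_N -> 'I_N -> R) (i j : 'I_N) (x : R) :
  'I_N -> 'I_N -> R :=
  fun a b => if (a == i) && (b == j) then x else q a b.

Definition irreducible (Rm : 'M[R]_N) : Prop :=
  forall a b : 'I_N, connect (fun u v : 'I_N => 0 < Rm v u) b a.

Definition stationary_distribution (Rm : 'M[R]_N) (p : 'cV[R]_N) : Prop :=
  Rm *m p = 0 /\ \sum_(a < N) p a ord0 = 1 /\ (forall a, 0 <= p a ord0).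

Definition expmx (A : 'M[R]_N) (t : R) : 'M[R]_N :=
  \matrix_(a, b)
    lim ((fun m : nat => (\sum_(n < m) ((t ^+ n / (n`!)%:R) *: A ^+ n)) a b)
           @ \oo).

Definition fundamental_matrix (Rm : 'M[R]_N) (p : 'cV[R]_N) : 'M[R]_N :=
  \matrix_(a, b)
    Rintegral lebesgue_measure `[0%R, +oo[
      (fun t : R => expmx Rm t a b - p a ord0).

End Defs.

(* Main.v *)
(** Write [d = e_i - e_j].  Since [pi 1^T] kills [d], the vector
    [w x := Z x d = \int_0^oo e^(R_x t) d dt] is the unique zero-sum solution of
    [R_x w = - d].  As [R_x - R_y = (x - y) d e_j^T], the vector [w y] satisfies
    [R_x (w y) = - (1 - (x - y) (w y)_j) d], so by uniqueness [w y] is a nonzero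
    multiple of [w x], and every ratio of their entries is the same.

    The integral converges because on zero-sum vectors the Lyapunov function
    [V u = \sum_a u_a^2 / pi_a] satisfies [V' = - D <= - c V] along
    [u' = R u], where [D] is the Dirichlet form and the Poincare constant [c]
    comes from paths in the irreducible transition graph. *)

Require Import Defs.
From HB Require Import structures.
From mathcomp Require Import all_boot all_order all_algebra.
From mathcomp Require Import all_classical all_reals all_analysis.
From mathcomp Require Import measurable_realfun.
From mathcomp Require Import ring lra.
Import Order.TTheory GRing.Theory Num.Theory.
Import numFieldNormedType.Exports.
Local Open Scope ring_scope.

(** * Entries of the matrix exponential as scalar power series *)

Section MatrixExponential.
Local Open Scope classical_set_scope.
Local Open Scope ring_scope.
Context {R : realType}.

Lemma is_derive_sumf (n : nat) (h : 'I_n -> R -> R) (dh : 'I_n -> R) (x : R) :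
  (forall i, is_derive x (1 : R) (h i) (dh i)) ->
  is_derive x (1 : R) (fun y => \sum_i h i y) (\sum_i dh i).
Proof.
move=> dfh; have := is_derive_sum dfh.
by congr (is_derive _ _ _ _); apply/funext => y; rewrite fct_sumE.
Qed.

Lemma is_derive_mulrf (f : R -> R) (c x df : R) :
  is_derive x (1 : R) f df -> is_derive x (1 : R) (fun y => f y * c) (df * c).
Proof.
move=> dfx; have := is_deriveZ c dfx.
by congr (is_derive _ _ _ _); [apply/funext => y |]; rewrite mulrC.
Qed.

Lemma is_derive_sqrf (f : R -> R) (x df : R) :
  is_derive x (1 : R) f df ->
  is_derive x (1 : R) (fun y => f y ^+ 2) (2 * f x * df).
Proof.
move=> dfx; have := is_deriveM dfx dfx.
by congr (is_derive _ _ _ _); rewrite /GRing.scale /=; ring.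
Qed.

Lemma is_cvg_pseries_exp_bound {c : nat -> R} {C M : R} (x : R) :
  0 <= C -> 0 <= M -> (forall n, `|c n| <= C * (M ^+ n / n`!%:R)) ->
  cvgn (pseries c x).
Proof.
move=> C0 M0 cb; apply: normed_cvg.
apply: (@series_le_cvg _ _ (fun n => C * exp_coeff (M * `|x|) n)) => //= [n|n|].
- by rewrite mulr_ge0// exp_coeff_ge0// mulr_ge0.
- rewrite /exp_coeff /= normrM normrX exprMn mulrAC mulrA.
  by rewrite ler_wpM2r ?exprn_ge0// -mulrA cb.
- rewrite (_ : (fun n => _) = C *: exp_coeff (M * `|x|)).
    exact/is_cvg_seriesZ/is_cvg_series_exp_coeff.
  by apply/funext => n; rewrite /GRing.scale /=.
Qed.

(** Termwise differentiation asks for convergence of the series and of its first two formal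
    derivatives at a point beyond [x]. The point [|x| + 1] serves, because the exponential bound
    survives each formal derivative. *)
Lemma is_derive_pseries_exp_bound {c : nat -> R} {C M : R} (x : R) :
  0 <= C -> 0 <= M -> (forall n, `|c n| <= C * (M ^+ n / n`!%:R)) ->
  is_derive x (1 : R) (fun y => limn (pseries c y))
    (limn (pseries (pseries_diffs c) x)).
Proof.
move=> C0 M0 cb.
(* The factor [n.+1] cancels against the factorial, so a formal derivative only turns [D] into
   [D * M]. *)
have diffs_bound (d : nat -> R) (D : R) :
    (forall n, `|d n| <= D * (M ^+ n / n`!%:R)) ->
    forall n, `|pseries_diffs d n| <= D * M * (M ^+ n / n`!%:R).
  move=> db n; rewrite /pseries_diffs normrM ger0_norm//.
  apply: (le_trans (ler_wpM2l _ (db n.+1))) => //.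
  rewrite factS natrM exprS invfM.
  rewrite [leLHS](_ : _ = D * M * (M ^+ n / n`!%:R) * (n.+1%:R / n.+1%:R)).
    by rewrite divff// mulr1.
  by ring.
apply: (@pseries_snd_diffs _ _ (`|x| + 1)).
- exact: is_cvg_pseries_exp_bound C0 M0 cb.
- exact: is_cvg_pseries_exp_bound (mulr_ge0 C0 M0) M0 (diffs_bound _ _ cb).
- exact: is_cvg_pseries_exp_bound (mulr_ge0 (mulr_ge0 C0 M0) M0) M0
    (diffs_bound _ _ (diffs_bound _ _ cb)).
- by rewrite [ltRHS]ger0_norm ?addr_ge0// ltrDl.
Qed.

Context {N : nat}.
Implicit Types A : 'M[R]_N.

Let expmx_coef A a b (n : nat) : R := (A ^+ n) a b / n`!%:R.

Let expmxE A a b t : expmx A t a b = limn (pseries (expmx_coef A a b) t).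
Proof.
rewrite mxE; congr (limn _); apply/funext => m.
rewrite /pseries /series /= big_mkord summxE.
by apply: eq_bigr => n _; rewrite mxE /expmx_coef; ring.
Qed.

(** The sum of all absolute entries dominates every row sum, so each further product by [A] costs at
    most one factor of it. *)
Let expmx_coef_bound A a b n :
  `|expmx_coef A a b n| <= 1 * ((\sum_c \sum_d `|A c d|) ^+ n / n`!%:R).
Proof.
rewrite mul1r /expmx_coef normrM [`|_^-1|]ger0_norm ?invr_ge0//.
rewrite ler_wpM2r ?invr_ge0//.
elim: n a b => [|n IHn] a b; first by rewrite !expr0 mxE normr_nat lern1 leq_b1.
rewrite !exprS mxE; apply: (le_trans (ler_norm_sum _ _ _)).
under eq_bigr do rewrite normrM.
apply: (@le_trans _ _ (\sum_c `|A a c| * (\sum_c \sum_d `|A c d|) ^+ n)).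
  by apply: ler_sum => c _; rewrite ler_wpM2l.
rewrite -mulr_suml ler_wpM2r ?exprn_ge0 ?sumr_ge0// => [c _|].
  by rewrite sumr_ge0.
by rewrite [leRHS](bigD1 a)//= lerDl sumr_ge0// => c _; rewrite sumr_ge0.
Qed.

Let norm_ge0 A : 0 <= \sum_c \sum_d `|A c d|.
Proof. by rewrite sumr_ge0// => c _; rewrite sumr_ge0. Qed.

Let lim_pseries_sum (g : 'I_N -> R) (c : 'I_N -> nat -> R) (d : nat -> R) t :
  (forall i, cvgn (pseries (c i) t)) ->
  (forall n, d n = \sum_i g i * c i n) ->
  limn (pseries d t) = \sum_i g i * limn (pseries (c i) t).
Proof.
move=> cc dE.
rewrite (_ : pseries d t = fun n => \sum_i g i * pseries (c i) t n).
  by apply/cvg_lim => //; apply: cvg_big => [|i _]; [exact: add_continuous|apply: cvgM; [exact: cvg_cst|exact: cc]].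
apply/funext => n; rewrite /pseries /series /=.
under [RHS]eq_bigr do rewrite mulr_sumr.
rewrite exchange_big /=; apply: eq_bigr => m _.
by rewrite dE mulr_suml; apply: eq_bigr => i _; rewrite mulrA.
Qed.

Let diffs_coef A a b n :
  pseries_diffs (expmx_coef A a b) n = (A ^+ n.+1) a b / n`!%:R.
Proof.
by rewrite /pseries_diffs /expmx_coef factS natrM invfM mulrCA mulVKf.
Qed.

(** Splitting [A ^+ n.+1] as [A * A ^+ n] puts the generator on the left, the form of the evolution
    equation [u' = A u]. The companion lemma splits it as [A ^+ n * A], the form to use when
    [A *m v] is known. *)
Lemma is_derive_expmxl A a b t :
  is_derive t (1 : R) (fun s => expmx A s a b) ((A *m expmx A t) a b).
Proof.
rewrite (_ : (fun s => _) = fun s => limn (pseries (expmx_coef A a b) s)).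
  have -> : (A *m expmx A t) a b
      = limn (pseries (pseries_diffs (expmx_coef A a b)) t).
    rewrite mxE (@lim_pseries_sum (A a) (fun c => expmx_coef A c b)) => [|c|n].
    - by apply: eq_bigr => c _; rewrite expmxE.
    - exact: is_cvg_pseries_exp_bound ler01 (norm_ge0 A) (expmx_coef_bound A c b).
    - rewrite diffs_coef exprS mxE mulr_suml.
      by apply: eq_bigr => c _; rewrite mulrA.
  exact: is_derive_pseries_exp_bound ler01 (norm_ge0 A) (expmx_coef_bound A a b).
by apply/funext => s; rewrite expmxE.
Qed.

Lemma is_derive_expmxr A a b t :
  is_derive t (1 : R) (fun s => expmx A s a b) ((expmx A t *m A) a b).
Proof.
rewrite (_ : (fun s => _) = fun s => limn (pseries (expmx_coef A a b) s)).
  have -> : (expmx A t *m A) a b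
      = limn (pseries (pseries_diffs (expmx_coef A a b)) t).
    rewrite mxE (@lim_pseries_sum (A^~ b) (fun c => expmx_coef A a c)) => [|c|n].
    - by apply: eq_bigr => c _; rewrite expmxE mulrC.
    - exact: is_cvg_pseries_exp_bound ler01 (norm_ge0 A) (expmx_coef_bound A a c).
    - rewrite diffs_coef exprSr mxE mulr_suml.
      by apply: eq_bigr => c _; rewrite /expmx_coef; ring.
  exact: is_derive_pseries_exp_bound ler01 (norm_ge0 A) (expmx_coef_bound A a b).
by apply/funext => s; rewrite expmxE.
Qed.

Lemma expmx0 A : expmx A 0 = 1%:M.
Proof.
apply/matrixP => a b; rewrite expmxE; apply/cvg_lim => //.
(* At time 0 only the term of index 0 survives, through [0 ^+ 0 = 1]; a partial sum contains it once
   [n] is positive. *)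
apply: cvg_near_cst; near=> n.
have n0 : (0 < n)%N by near: n; exact: nbhs_infty_gt.
rewrite /pseries /series /= big_mkord -(prednK n0).
rewrite big_ord_recl big1 => [|i _]; last by rewrite expr0n /= mulr0.
by rewrite /expmx_coef !expr0 fact0 divr1 mulr1 addr0.
Unshelve. all: by end_near. Qed.

Lemma is_derive_expmx_mull A (v : 'cV[R]_N) a t :
  is_derive t (1 : R) (fun s => (expmx A s *m v) a ord0)
    ((A *m (expmx A t *m v)) a ord0).
Proof.
rewrite mulmxA mxE.
rewrite (_ : (fun s => _) = fun s => \sum_b expmx A s a b * v b ord0).
  apply: is_derive_sumf => b; apply: is_derive_mulrf; exact: is_derive_expmxl.
by apply/funext => s; rewrite mxE.
Qed.

Lemma is_derive_expmx_mulr A (v : 'cV[R]_N) a t :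
  is_derive t (1 : R) (fun s => (expmx A s *m v) a ord0)
    ((expmx A t *m (A *m v)) a ord0).
Proof.
rewrite mulmxA mxE.
rewrite (_ : (fun s => _) = fun s => \sum_b expmx A s a b * v b ord0).
  apply: is_derive_sumf => b; apply: is_derive_mulrf; exact: is_derive_expmxr.
by apply/funext => s; rewrite mxE.
Qed.

Lemma expmx_fixed A (v : 'cV[R]_N) t : A *m v = 0 -> expmx A t *m v = v.
Proof.
move=> Av0; apply/matrixP => a z; rewrite (ord1 z).
rewrite -[in RHS](mul1mx v) -(expmx0 A).
apply: (@is_derive_0_is_cst _ (fun s => (expmx A s *m v) a ord0)) => s.
by have := is_derive_expmx_mulr A v a s; rewrite Av0 mulmx0 mxE.
Qed.

End MatrixExponential.

(** * Improper integrals over the half-line under exponential decay *)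

Section HalfLineIntegral.
Local Open Scope classical_set_scope.
Local Open Scope ring_scope.
Context {R : realType}.
Local Notation mu := (@lebesgue_measure R).
Implicit Types (f F : R -> R) (C m l : R).

Lemma is_derive_expRM (c t : R) :
  is_derive t (1 : R) (fun s => expR (c * s)) (c * expR (c * t)).
Proof.
have d : is_derive t (1 : R) (fun s : R => c * s) c.
  have := is_deriveZ c (is_derive_id t (1 : R)).
  by congr (is_derive _ _ _ _); rewrite /GRing.scale /= mulr1.
have /= := @is_derive1_comp _ (@expR R) (fun s => c * s) t _ _
  (is_derive_expR _) d.
by rewrite mulrC.
Qed.

Lemma cvg_expRM_pinfty m : 0 < m -> expR (- m * t) @[t --> +oo] --> (0 : R).
Proof.
move=> m0.
under eq_cvg do rewrite mulNr.
apply: (@cvg_comp _ _ _ (fun t : R => m * t) (fun t => expR (- t))); last first.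
  exact: cvgr_expR.
exact: gt0_cvgMry.
Qed.

Lemma cvg0_exp_bound f C m : 0 < m ->
  (forall t, 0 <= t -> `|f t| <= C * expR (- m * t)) ->
  f t @[t --> +oo] --> (0 : R).
Proof.
move=> m0 fb; apply: norm_cvg0.
apply: (@squeeze_cvgr _ _ _ _ (cst 0) (fun t => C * expR (- m * t))).
- near=> t; rewrite normr_ge0 /= fb//; near: t; exact: nbhs_pinfty_ge.
- exact: cvg_cst.
- rewrite -[X in _ --> X](mulr0 C); apply: cvgM; [exact: cvg_cst|exact: cvg_expRM_pinfty].
Unshelve. all: by end_near. Qed.

Lemma Rintegral_FTC2y_exp_bound f F C m l : 0 < m ->
  (forall t, is_derive t (1 : R) F (f t)) -> continuous f ->
  (forall t, 0 <= t -> `|f t| <= C * expR (- m * t)) ->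
  F t @[t --> +oo] --> l ->
  Rintegral mu `[0, +oo[%classic f = l - F 0.
Proof.
move=> m0 dF cf fb Fl.
have m_neq0 : m != 0 by rewrite gt_eqF.
(* The library's half-line FTC needs a nonnegative integrand, hence [f + e]. *)
pose e t := C * expR (- m * t); pose E t := - (C / m) * expR (- m * t).
have dE t : is_derive t (1 : R) E (e t).
  have := is_deriveZ (- (C / m)) (is_derive_expRM (- m) t).
  by congr (is_derive _ _ _ _); rewrite /e /GRing.scale /=; field.
have is_derive_continuous (G : R -> R) (g : R -> R) t :
    (forall s, is_derive s (1 : R) G (g s)) -> {for t, continuous G}.
  by move=> dG; apply/differentiable_continuous/derivable1_diffP; case: (dG t).
have ce : continuous e.
  move=> t; apply: (@is_derive_continuous _ (fun s => C * (- m * expR (- m * s)))) => s.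
  have := is_deriveZ C (is_derive_expRM (- m) s).
  by congr (is_derive _ _ _ _).
have El : E t @[t --> +oo] --> (0 : R).
  by rewrite -[X in _ --> X](mulr0 (- (C / m))); apply: cvgM; [exact: cvg_cst|exact: cvg_expRM_pinfty].
have FTC (g G : R -> R) (k : R) : (forall t, 0 <= t -> 0 <= g t) -> continuous g ->
    (forall t, is_derive t (1 : R) G (g t)) -> G t @[t --> +oo] --> k ->
    (\int[mu]_(t in `[0%R, +oo[) (g t)%:E = k%:E - (G 0)%:E)%E.
  move=> g0 cg dG Gk; apply: ge0_continuous_FTC2y => //.
  - exact: continuous_subspaceT.
  - by apply: cvg_at_right_filter; exact: (is_derive_continuous _ _ _ dG).
  - by move=> t _; rewrite derive1E; apply: derive_val.
have e_ge0 t : 0 <= t -> 0 <= e t by move=> t0; exact: le_trans (fb t t0).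
have fe_ge0 t : 0 <= t -> 0 <= f t + e t.
  by move=> t0; have := fb t t0; rewrite ler_norml => /andP[+ _]; rewrite -subr_ge0 opprK.
have int_e := FTC e E 0 e_ge0 ce dE El.
have cfe : continuous (fun t => f t + e t).
  by move=> t; apply: cvgD; [exact: cf|exact: ce].
have int_fe : (\int[mu]_(t in `[0%R, +oo[) (f t + e t)%:E
    = (l + 0)%:E - (F 0 + E 0)%:E)%E.
  apply: (FTC (fun t => f t + e t) (fun t => F t + E t)) => //.
  exact: cvgD.
have mfun (g : R -> R) : continuous g ->
    measurable_fun (`[0, +oo[%classic : set R) g.
  move=> cg; apply: subspace_continuous_measurable_fun => //.
  exact: continuous_subspaceT.
(* Integrability of a nonnegative function is read off the finite value of its integral; it licenses
   splitting the integral of [(f + e) - e] below. *)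
have integ (g : R -> R) (k : R) : (forall t, 0 <= t -> 0 <= g t) ->
    continuous g -> (\int[mu]_(t in `[0%R, +oo[) (g t)%:E = k%:E)%E ->
    mu.-integrable (`[0, +oo[%classic : set R) (EFin \o g).
  move=> g0 cg gk; apply/integrableP; split; first by apply/measurable_EFinP; exact: mfun.
  under eq_integral => t.
    rewrite inE /= in_itv /= andbT => t0.
    rewrite ger0_norm ?g0//; over.
  by rewrite gk ltry.
have ie := integ e _ e_ge0 ce int_e.
have ife := integ _ _ fe_ge0 cfe int_fe.
transitivity (Rintegral mu `[0, +oo[%classic (fun t => (f t + e t) - e t)).
  by apply: eq_Rintegral => t _; rewrite addrK.
rewrite RintegralB//.
by rewrite /Rintegral int_e int_fe /=; lra.
Qed.

End HalfLineIntegral.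

(** * Dirichlet form and Poincare inequality *)

Section DirichletForm.
Context {R : realType} {N : nat}.
Implicit Types (Q : 'M[R]_N) (p : 'cV[R]_N) (y : 'I_N -> R).

(** Twice the usual Dirichlet form when [Q a b] is the stationary flow from [b] to [a]. The diagonal
    of [Q], which is negative for a generator, drops out. *)
Definition dirichlet Q y := \sum_a \sum_b Q a b * (y a - y b) ^+ 2.

(** Once the square is expanded, zero row sums cancel the terms in [y a ^+ 2] and zero column sums
    those in [y b ^+ 2]; the cross terms remain. Reversible or not, a stationary flow has both kinds
    of sums zero. *)
Lemma dirichletE Q y :
  (forall a, \sum_b Q a b = 0) -> (forall b, \sum_a Q a b = 0) ->
  \sum_a 2 * y a * (\sum_b Q a b * y b) = - dirichlet Q y.
Proof.
move=> rows cols; apply/eqP; rewrite -addr_eq0; apply/eqP.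
have -> : dirichlet Q y = \sum_a \sum_b (Q a b * y a ^+ 2)
    + \sum_a \sum_b (Q a b * y b ^+ 2) - \sum_a 2 * y a * (\sum_b Q a b * y b).
  rewrite -sumrN -!big_split /=; apply: eq_bigr => a _.
  by rewrite mulr_sumr -sumrN -!big_split /=; apply: eq_bigr => b _; ring.
rewrite [X in _ + (X + _ - _)]big1 => [|a _].
  rewrite exchange_big [X in _ + (_ + X - _)]big1 => [|b _]; first by ring.
  by rewrite -mulr_suml cols mul0r.
by rewrite -mulr_suml rows mul0r.
Qed.

Lemma dirichlet_ge_term Q y a b :
  (forall a b, a != b -> 0 <= Q a b) ->
  Q a b * (y a - y b) ^+ 2 <= dirichlet Q y.
Proof.
move=> Q0.
have term_ge0 c d : 0 <= Q c d * (y c - y d) ^+ 2.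
  have [->|cd] := eqVneq c d; first by rewrite subrr expr0n /= mulr0.
  by rewrite mulr_ge0 ?sqr_ge0// Q0.
rewrite /dirichlet (bigD1 a)//= (bigD1 b)//= -addrA lerDl addr_ge0 ?sumr_ge0//.
by move=> c _; rewrite sumr_ge0.
Qed.

(** Induction along a path from [b] to [a]: the increment over the first edge is controlled by a
    single term of the form, the rest by induction. The constant depends on the path but not on
    [y]. *)
Lemma dirichlet_path_bound Q a b :
  (forall a b, a != b -> 0 <= Q a b) ->
  connect (fun u v => 0 < Q v u) b a ->
  exists2 K, 0 <= K & forall y, (y a - y b) ^+ 2 <= K * dirichlet Q y.
Proof.
move=> Q0 /connectP [s + ->]; elim: s b => [|c s IHs] b /=.
  by move=> _; exists 0 => // y; rewrite subrr expr0n mul0r.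
move=> /andP[Qcb /IHs [K K0 Kb]]; exists (2 * (K + (Q c b)^-1)).
  by rewrite mulr_ge0// addr_ge0// invr_ge0 ltW.
move=> y; have := Kb y; set D := dirichlet Q y; set z := y _.
have : (y c - y b) ^+ 2 <= (Q c b)^-1 * D.
  by rewrite -[leLHS](mulKf (lt0r_neq0 Qcb)) ler_pM2l ?invr_gt0// dirichlet_ge_term.
(* This square yields [(s + t) ^+ 2 <= 2 * s ^+ 2 + 2 * t ^+ 2] for the two increments. *)
have : 0 <= (z - y c - (y c - y b)) ^+ 2 by exact: sqr_ge0.
move: (Q c b)^-1 => q; nra.
Qed.

(** For a mean-zero [y] the second moment is half the weighted sum of squared differences over all
    pairs of states, and the path bounds control each pair. *)
Lemma poincare Q p :
  (forall a b, a != b -> 0 <= Q a b) ->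
  (forall a b, connect (fun u v => 0 < Q v u) b a) ->
  (forall a, 0 <= p a ord0) -> \sum_a p a ord0 = 1 ->
  exists2 c, 0 < c & forall y, \sum_a p a ord0 * y a = 0 ->
    c * (\sum_a p a ord0 * y a ^+ 2) <= dirichlet Q y.
Proof.
move=> Q0 conn p0 p1.
have /choice [K KP] : forall ab : 'I_N * 'I_N, exists K, 0 <= K /\
    forall y, (y ab.1 - y ab.2) ^+ 2 <= K * dirichlet Q y.
  by move=> [a b]; have [K K0 Kb] := dirichlet_path_bound _ _ _ Q0 (conn a b); exists K.
(* The summand 1 keeps [M] positive even if all the chosen path constants vanish. *)
pose M := 1 + \sum_a \sum_b p a ord0 * p b ord0 * K (a, b).
have M_gt0 : 0 < M.
  rewrite ltr_pwDl// sumr_ge0// => a _; rewrite sumr_ge0// => b _.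
  by rewrite !mulr_ge0//; case: (KP (a, b)).
exists (2 / M); first by rewrite divr_gt0.
move=> y py0.
have D0 : 0 <= dirichlet Q y.
  rewrite sumr_ge0// => a _; rewrite sumr_ge0// => b _.
  have [->|ab] := eqVneq a b; first by rewrite subrr expr0n /= mulr0.
  by rewrite mulr_ge0 ?sqr_ge0// Q0.
(* Expanding the square, [\sum p = 1] and [\sum p y = 0] kill the cross terms. *)
have pairs : \sum_a \sum_b p a ord0 * p b ord0 * (y a - y b) ^+ 2
    = 2 * \sum_a p a ord0 * y a ^+ 2.
  transitivity (\sum_a (p a ord0 * y a ^+ 2 * (\sum_b p b ord0)
      + p a ord0 * (\sum_b p b ord0 * y b ^+ 2)
      - 2 * p a ord0 * y a * \sum_b p b ord0 * y b)).
    apply: eq_bigr => a _; rewrite !mulr_sumr -sumrN -!big_split /=.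
    by apply: eq_bigr => b _; ring.
  under eq_bigr do rewrite p1 py0 mulr1 mulr0 subr0.
  by rewrite big_split /= -mulr_suml p1; ring.
rewrite mulrAC ler_pdivrMr// -pairs mulrDr mulr1.
apply: (@le_trans _ _ (dirichlet Q y *
    \sum_a \sum_b p a ord0 * p b ord0 * K (a, b))); last by rewrite lerDr.
rewrite mulr_sumr; apply: ler_sum => a _; rewrite mulr_sumr.
apply: ler_sum => b _; rewrite [leRHS]mulrCA ler_wpM2l ?mulr_ge0//.
by rewrite [leRHS]mulrC; case: (KP (a, b)).
Qed.

End DirichletForm.

(** * Irreducible generators: kernel, decay and fundamental matrix *)

Section MarkovGenerator.
Context {R : realType} {N : nat}.
Local Open Scope classical_set_scope.
Local Open Scope ring_scope.
Variables (A : 'M[R]_N) (p : 'cV[R]_N).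
Hypothesis offdiag_ge0 : forall a b, a != b -> 0 <= A a b.
Hypothesis colsum0 : forall b, \sum_a A a b = 0.
Hypothesis irrA : irreducible A.
Hypothesis statp : stationary_distribution A p.

Let p_ge0 a : 0 <= p a ord0. Proof. by case: statp => _ []. Qed.
Let p_sum1 : \sum_a p a ord0 = 1. Proof. by case: statp => _ []. Qed.
Let Ap0 : A *m p = 0. Proof. by case: statp. Qed.

(** At a state of mass 0, stationarity forces zero inflow, so every predecessor has mass 0 too.
    Going back along paths empties all states, against total mass 1. *)
Let p_gt0 a : 0 < p a ord0.
Proof.
rewrite lt0r p_ge0 andbT; apply/eqP => pa0.
have back u v : 0 < A v u -> p v ord0 = 0 -> p u ord0 = 0.
  move=> Avu pv0; have [->//|uv] := eqVneq u v.
  have := congr1 (fun M : 'cV[R]_N => M v ord0) Ap0.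
  rewrite !mxE (bigD1 v)//= pv0 mulr0 add0r => /eqP.
  rewrite psumr_eq0 => [|c cv]; last by rewrite mulr_ge0// offdiag_ge0// eq_sym.
  move=> /allP /(_ u); rewrite mem_index_enum uv mulf_eq0 gt_eqF//= => h.
  by apply/eqP/h.
have all0 b : p b ord0 = 0.
  have /connectP [s + aE] := irrA a b; rewrite aE in pa0.
  elim: s b pa0 {aE} => [|c s IHs] b //= pl0 /andP[Acb /(IHs c pl0)].
  exact: back.
by move: p_sum1; rewrite big1// => /eqP; rewrite eq_sym oner_eq0.
Qed.

(** The stationary flow from [b] to [a]. Its row sums vanish by stationarity and its column sums by
    conservation of probability; as [p] is positive, it has the transition graph of [A]. *)
Let Q : 'M[R]_N := \matrix_(a, b) (A a b * p b ord0).

Let Q_ge0 a b : a != b -> 0 <= Q a b.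
Proof. by move=> ab; rewrite mxE mulr_ge0 ?offdiag_ge0. Qed.

Let Q_rows a : \sum_b Q a b = 0.
Proof.
have := congr1 (fun M : 'cV[R]_N => M a ord0) Ap0.
rewrite !mxE => pa; rewrite -[RHS]pa; apply: eq_bigr => b _; exact: mxE.
Qed.

Let Q_cols b : \sum_a Q a b = 0.
Proof.
under eq_bigr do rewrite mxE.
by rewrite -mulr_suml colsum0 mul0r.
Qed.

Let Q_connect a b : connect (fun u v => 0 < Q v u) b a.
Proof.
rewrite (@eq_connect _ _ (fun u v => 0 < A v u)) => [|u v]; first exact: irrA.
by rewrite mxE pmulr_lgt0.
Qed.

Lemma generator_sum (v : 'cV[R]_N) : \sum_a (A *m v) a ord0 = 0.
Proof.
under eq_bigr do rewrite mxE.
by rewrite exchange_big big1// => b _; rewrite -mulr_suml colsum0 mul0r.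
Qed.

(** For the density [y = v / p], pairing [A *m v] with [2 y] gives minus the Dirichlet form, which
    is therefore 0; the Poincare inequality then kills the second moment of [y]. *)
Lemma generator_ker (v : 'cV[R]_N) :
  A *m v = 0 -> \sum_a v a ord0 = 0 -> v = 0.
Proof.
move=> Av0 v0; pose y a := v a ord0 / p a ord0.
have pyE a : p a ord0 * y a = v a ord0 by rewrite mulrC divfK// gt_eqF.
have [c c0 cb] := poincare _ _ Q_ge0 Q_connect p_ge0 p_sum1.
have D0 : dirichlet Q y = 0.
  rewrite -[LHS]opprK -(dirichletE Q)// big1 ?oppr0// => a _.
  have -> : \sum_b Q a b * y b = (A *m v) a ord0.
    by rewrite [RHS]mxE; apply: eq_bigr => b _; rewrite mxE -mulrA pyE.
  by rewrite Av0 mxE mulr0.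
have V0 : \sum_a p a ord0 * y a ^+ 2 = 0.
  apply/eqP; rewrite eq_le sumr_ge0 ?andbT => [|a _]; last first.
    by rewrite mulr_ge0 ?sqr_ge0.
  have := cb y; rewrite D0 pmulr_rle0//; apply.
  by under eq_bigr do rewrite pyE.
apply/matrixP => a z; rewrite (ord1 z) mxE -pyE.
move/eqP: V0; rewrite psumr_eq0 => [|b _]; last by rewrite mulr_ge0 ?sqr_ge0.
move=> /allP /(_ a); rewrite mem_index_enum => /(_ isT).
by rewrite mulf_eq0 sqrf_eq0 => /orP[] /eqP ->; rewrite ?mul0r ?mulr0.
Qed.

(** The rank-one correction [B = A - p 1^T] agrees with [A] on zero-sum vectors and negates the
    total of every vector. Hence [B] is injective, so invertible, and its inverse preserves zero-sum
    vectors. *)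
Lemma generator_solve (v : 'cV[R]_N) : \sum_a v a ord0 = 0 ->
  exists2 w : 'cV[R]_N, A *m w = v & \sum_a w a ord0 = 0.
Proof.
move=> v0; pose B := A - p *m const_mx 1.
have BE (w : 'cV[R]_N) : B *m w = A *m w - (\sum_a w a ord0) *: p.
  rewrite mulmxBl -mulmxA; congr (_ - _).
  apply/matrixP => a z; rewrite (ord1 z) mxE big_ord1 !mxE mulrC; congr (_ * _).
  by apply: eq_bigr => b _; rewrite mxE mul1r.
have Bsum (w : 'cV[R]_N) : \sum_a (B *m w) a ord0 = - \sum_a w a ord0.
  transitivity (\sum_a (A *m w) a ord0 - \sum_a (\sum_b w b ord0) * p a ord0).
    rewrite BE -sumrB; apply: eq_bigr => a _.
    by rewrite mxE [X in _ + X]mxE [X in _ - X]mxE.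
  by rewrite generator_sum sub0r -mulr_sumr p_sum1 mulr1.
have Bker (w : 'cV[R]_N) : B *m w = 0 -> w = 0.
  move=> Bw0; have w0 : \sum_a w a ord0 = 0.
    rewrite -[LHS]opprK -Bsum Bw0 big1 ?oppr0// => a _; exact: mxE.
  by apply: generator_ker => //; rewrite -Bw0 BE w0 scale0r subr0.
have uB : B \in unitmx.
  (* [inj_row_free] tests the kernel on row vectors; transposing turns it into the column kernel of
     [B]. *)
  rewrite -unitmx_tr -row_free_unit; apply: inj_row_free => r rB.
  apply: trmx_inj; rewrite trmx0; apply: Bker.
  by rewrite -[B]trmxK -trmx_mul rB trmx0.
have Bw : B *m (invmx B *m v) = v by rewrite mulmxA mulmxV// mul1mx.
have w0 : \sum_a (invmx B *m v) a ord0 = 0.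
  by rewrite -[LHS]opprK -Bsum Bw v0 oppr0.
by exists (invmx B *m v) => //; rewrite -[RHS]Bw BE w0 scale0r subr0.
Qed.

Lemma expmx_sum (v : 'cV[R]_N) t :
  \sum_a (expmx A t *m v) a ord0 = \sum_a v a ord0.
Proof.
transitivity (\sum_a (expmx A 0 *m v) a ord0); last by rewrite expmx0 mul1mx.
apply: (@is_derive_0_is_cst _ (fun s => \sum_a (expmx A s *m v) a ord0)) => s.
by have := is_derive_sumf _ _ _ _ (fun a => is_derive_expmx_mull A v a s);
  rewrite generator_sum.
Qed.

Lemma expmx_decay : exists2 m, 0 < m & forall v : 'cV[R]_N,
  \sum_a v a ord0 = 0 -> exists C, forall a t, 0 <= t ->
  `|(expmx A t *m v) a ord0| <= C * expR (- m * t).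
Proof.
have [c c0 cb] := poincare _ _ Q_ge0 Q_connect p_ge0 p_sum1.
(* [V] is quadratic in the entries and decays at rate [c], hence the half. *)
exists (c / 2); first by rewrite divr_gt0.
move=> v v0; pose u t a := (expmx A t *m v) a ord0.
pose y t a := u t a / p a ord0.
have pyE t a : p a ord0 * y t a = u t a by rewrite mulrC divfK// gt_eqF.
pose V t := \sum_a u t a ^+ 2 / p a ord0.
have VE t : V t = \sum_a p a ord0 * y t a ^+ 2.
  apply: eq_bigr => a _; by rewrite -pyE; field; rewrite gt_eqF.
  have dV t : is_derive t (1 : R) V (- dirichlet Q (y t)).
  rewrite -dirichletE//; apply: is_derive_sumf => a.
  have := is_derive_mulrf _ (p a ord0)^-1 _ _
    (is_derive_sqrf _ _ _ (is_derive_expmx_mull A v a t)).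
  congr (is_derive _ _ _ _); rewrite -/(u t a).
  have -> : \sum_b Q a b * y t b = (A *m (expmx A t *m v)) a ord0.
    by rewrite [RHS]mxE; apply: eq_bigr => b _; rewrite mxE -mulrA pyE.
  by rewrite mulrAC mulrA.
(* Gronwall's argument: [V' <= - c V] makes [V t * expR (c * t)] nonincreasing. *)
pose G t := V t * expR (c * t).
have dG t : is_derive t (1 : R) G
    ((c * V t - dirichlet Q (y t)) * expR (c * t)).
  have := is_deriveM (dV t) (is_derive_expRM c t).
  by congr (is_derive _ _ _ _); rewrite /GRing.scale /=; ring.
have Gdecr t : 0 <= t -> G t <= G 0.
  move=> t0; apply: (@ler0_derive1_nincry _ G 0) => //.
  - move=> s _; rewrite derive1E (@derive_val _ _ _ _ _ _ _ (dG s)).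
    rewrite mulr_le0_ge0 ?expR_ge0// subr_le0 VE; apply: cb.
    by under eq_bigr do rewrite pyE; rewrite expmx_sum.
  - apply: continuous_subspaceT => s.
    by apply/differentiable_continuous/derivable1_diffP; case: (dG s).
have V_ge0 t : 0 <= V t.
  by rewrite sumr_ge0// => a _; rewrite divr_ge0 ?sqr_ge0.
(* Since [V 0 <= (1 + V 0) ^+ 2], this constant replaces the square root of [V 0]. *)
exists (1 + V 0) => a t t0.
have p_le1 : p a ord0 <= 1 by rewrite -p_sum1 (bigD1 a)//= lerDl sumr_ge0.
have uV : u t a ^+ 2 <= V t.
  apply: (@le_trans _ _ (u t a ^+ 2 / p a ord0)).
    by rewrite ler_pdivlMr// ler_piMr ?sqr_ge0.
  by rewrite /V (bigD1 a)//= lerDl sumr_ge0// => b _; rewrite divr_ge0 ?sqr_ge0.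
have Vdecay : V t <= V 0 * expR (- (c / 2) * t) ^+ 2.
  have := Gdecr t t0; rewrite /G mulr0 expR0 mulr1 -ler_pdivlMr ?expR_gt0//.
  rewrite -expRN -expRM_natl; congr (_ <= _ * expR _); by field.
rewrite -[leRHS]ger0_norm ?mulr_ge0 ?expR_ge0 ?addr_ge0// -ler_sqr ?nnegrE//.
rewrite !real_normK ?num_real//; apply: (le_trans uV); apply: (le_trans Vdecay).
rewrite exprMn ler_wpM2r ?sqr_ge0//; have := V_ge0 0; nra.
Qed.

(** As the exponential fixes [p], the integrand in column [b] is minus the evolution of
    [v = p - e_b]. If [A w = v], it is the derivative of minus the evolution of [w], which runs from
    [- w] at time 0 to 0 at infinity because [w] is zero-sum. *)
Lemma fundamental_matrixP b : exists2 w : 'cV[R]_N,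
  A *m w = p - delta_mx b ord0 /\ \sum_a w a ord0 = 0 &
  forall a, fundamental_matrix A p a b = w a ord0.
Proof.
pose v := p - delta_mx b ord0 : 'cV[R]_N.
have v0 : \sum_a v a ord0 = 0.
  under eq_bigr do rewrite !mxE.
  rewrite big_split /= sumrN p_sum1 (bigD1 b)//= eqxx big1 ?addr0 ?subrr//.
  by move=> c /negbTE ->.
have [w Aw w0] := generator_solve v v0; exists w => // a.
have [m m0 decay] := expmx_decay.
have [C1 decay_v] := decay v v0; have [C2 decay_w] := decay w w0.
have vE t : (expmx A t *m v) a ord0 = - (expmx A t a b - p a ord0).
  by rewrite mulmxBr expmx_fixed// -colE mxE [X in _ + X]mxE [X in _ - X]mxE opprB.
have dF t : is_derive t (1 : R) (fun s => - (expmx A s *m w) a ord0)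
    (expmx A t a b - p a ord0).
  have := is_deriveN (is_derive_expmx_mulr A w a t).
  by rewrite Aw vE opprK.
rewrite mxE (@Rintegral_FTC2y_exp_bound _ _ _ C1 m 0 m0 dF).
- by rewrite expmx0 mul1mx opprK add0r.
- move=> t; apply: cvgB; last exact: cvg_cst.
  by apply/differentiable_continuous/derivable1_diffP; case: (is_derive_expmxl A a b t).
- by move=> t t0; rewrite -normrN -vE decay_v.
- apply: (@cvg0_exp_bound _ _ C2 m) => // t t0; rewrite normrN; exact: decay_w.
Qed.

End MarkovGenerator.

(** * Rank-one effect of changing a single rate *)

Section SingleRate.
Context {R : realType} {N : nat}.
Variables (q : 'I_N -> 'I_N -> R) (i j : 'I_N).
Hypothesis ij : i != j.

Let d : 'cV[R]_N := delta_mx i ord0 - delta_mx j ord0.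

Lemma ratemx_colsum (r : 'I_N -> 'I_N -> R) b : \sum_a ratemx r a b = 0.
Proof.
rewrite (bigD1 b)//= mxE eqxx addrC; apply/eqP; rewrite subr_eq0; apply/eqP.
by apply: eq_bigr => a ab; rewrite mxE (negbTE ab).
Qed.

Lemma ratemx_setrate_mul x y (w : 'cV[R]_N) :
  ratemx (setrate q i j x) *m w =
  ratemx (setrate q i j y) *m w + ((x - y) * w j ord0) *: d.
Proof.
have -> : ratemx (setrate q i j x) =
    ratemx (setrate q i j y) + (x - y) *: (d *m delta_mx ord0 j).
  apply/matrixP => a b; rewrite !mxE big_ord1 !mxE !eqxx andbT /=.
  have [->|bj] := eqVneq b j; last first.
    have rb c : setrate q i j x c b = setrate q i j y c b.
      by rewrite /setrate (negbTE bj) andbF.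
    by rewrite mulr0 mulr0 addr0 rb; under eq_bigr do rewrite rb.
  have [->|aj] := eqVneq a j.
    (* On the diagonal the rate [r_ij] enters through the term [c = i] of the column sum, whence the
       entry -1 of [d] at [j]. *)
    rewrite (bigD1 i)//= [in RHS](bigD1 i)//= /setrate !eqxx [j == i]eq_sym.
    rewrite (negbTE ij) /=.
    under eq_bigr => c /andP[_ /negbTE ->] do rewrite /=.
    under [in RHS]eq_bigr => c /andP[_ /negbTE ->] do rewrite /=.
    by ring.
  by rewrite /setrate eqxx !andbT; case: eqP => _ /=; ring.
rewrite mulmxDl -scalemxAl -mulmxA -scalerA; congr (_ + _ *: _).
apply/matrixP => a z; rewrite (ord1 z) -rowE mxE big_ord1 [X in _ * X]mxE.
by rewrite [RHS]mxE mulrC.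
Qed.

End SingleRate.

Theorem theorem1 (R : realType) (N : nat) (q : 'I_N -> 'I_N -> R)
  (i j k l : 'I_N) (pi : R -> 'cV[R]_N) :
  (forall a b : 'I_N, a != b -> 0 <= q a b) ->
  i != j -> k != i -> k != j -> l != i -> l != j ->
  (forall x : R, 0 < x -> irreducible (ratemx (setrate q i j x))) ->
  (forall x : R, 0 < x ->
     stationary_distribution (ratemx (setrate q i j x)) (pi x)) ->
  let Z := fun x : R => fundamental_matrix (ratemx (setrate q i j x)) (pi x) in
  let chi := fun x : R => (Z x k i - Z x k j) / (Z x l i - Z x l j) in
  forall x : R, 0 < x -> Z x l i - Z x l j != 0 ->
    is_derive x (1 : R) chi 0.
Proof.
move=> q_ge0 ij _ _ _ _ irr stat Z chi x x0 _.
pose A y := ratemx (setrate q i j y).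
pose d : 'cV[R]_N := delta_mx i ord0 - delta_mx j ord0.
have off y : 0 < y -> forall a b, a != b -> 0 <= A y a b.
  move=> y0 a b ab; rewrite mxE (negbTE ab) /setrate.
  by case: ifP => _; [exact: ltW|exact: q_ge0].
have col y b : \sum_a A y a b = 0 by exact: ratemx_colsum.
have ZP y : 0 < y -> exists w : 'cV[R]_N,
    [/\ A y *m w = - d, \sum_a w a ord0 = 0 &
        forall a, Z y a i - Z y a j = w a ord0].
  move=> y0.
  have ZPb := fundamental_matrixP _ _ (off y y0) (col y) (irr y y0) (stat y y0).
  have [wi [Awi wi0] Zi] := ZPb i; have [wj [Awj wj0] Zj] := ZPb j.
  (* The stationary vector cancels between columns [i] and [j], leaving [- d]. *)
  exists (wi - wj); split => [||a].
  - rewrite mulmxBr Awi Awj /d !opprB; apply/matrixP => a b.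
    by rewrite !mxE; ring.
  - under eq_bigr do rewrite !mxE.
    by rewrite sumrB wi0 wj0 subrr.
  - by rewrite Zi Zj !mxE.
have [w [Aw w0 Zw]] := ZP x x0.
have chi_cst y : 0 < y -> chi y = chi x.
  move=> y0; have [v [Av v0 Zv]] := ZP y y0.
  (* The rank-one formula gives [A x *m v = - c *: d], so [v - c *: w] is a zero-sum vector in the
     kernel of [A x]. *)
  pose c := 1 - (x - y) * v j ord0.
  have vE : v = c *: w.
    apply/eqP; rewrite -subr_eq0; apply/eqP.
    apply: (generator_ker _ _ (off x x0) (col x) (irr x x0) (stat x x0)).
      rewrite mulmxBr -scalemxAr Aw (@ratemx_setrate_mul _ _ q i j ij x y).
      rewrite -/(A y) Av -/d /c; apply/matrixP => a b; rewrite !mxE; ring.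
    under eq_bigr do rewrite !mxE.
    by rewrite sumrB -mulr_sumr v0 w0 mulr0 subrr.
  (* If [c] were 0, [v] would vanish, whereas [A y *m v = - d] has entry -1 at [i]. *)
  have c_neq0 : c != 0.
    apply/eqP => c0; move: Av; rewrite vE c0 scale0r mulmx0.
    move/matrixP/(_ i ord0); rewrite !mxE !eqxx (negbTE ij) /= subr0 => /eqP.
    by rewrite eq_sym oppr_eq0 oner_eq0.
  by rewrite /chi !Zw !Zv vE !mxE -mulf_div divff// mul1r.
(* The positive rates form a neighbourhood of [x], so [chi] is locally constant there. *)
have near_chi : \forall y \near x, chi x = chi y.
  by near=> y; rewrite chi_cst//; near: y; exact: lt_nbhsr.
exact: near_eq_is_derive near_chi (is_derive_cst (chi x) x 1).
Unshelve. all: by end_near. Qed.
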